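(* Let $M$ be a nonnegative matrix with $r=\operatorname{rank}(M)$ and $r_+=\operatorname{rank}_+(M)$. Then $$\operatorname{rank}_+^*(M)\;\le\;\max_{r\le r_u\le r_+}\operatorname{faces}(r_+,\,r_u-1,\,r_u-r),$$ where the maximum is over integers $r_u$.
   Context: For $M\in\mathbb{R}^{m\times n}_+$ (entrywise nonnegative), the nonnegative rank $\operatorname{rank}_+(M)$ is the minimum $k$ such that there exist $U\in\mathbb{R}^{m\times k}_+$, $V\in\mathbb{R}^{k\times n}_+$ with $M=UV$. The restricted nonnegative rank $\operatorname{rank}_+^*(M)$ is the minimum $k$ such that there exist $U\in\mathbb{R}^{m\times k}_+$, $V\in\mathbb{R}^{k\times n}_+$ with $M=UV$ and $\operatorname{rank}(U)=\operatorname{rank}(M)$. $\operatorname{faces}(n,d,k)$ denotes the maximal number of $k$-faces ($k$-dimensional faces) of a polytope with $n$ vertices in dimension $d$ (i.e. a $d$-dimensional polytope). *)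

(* Defs.v *)
From HB Require Import structures.
From mathcomp Require Import all_boot all_order all_algebra.
From mathcomp Require Import all_classical all_reals.

Set Implicit Arguments.
Unset Strict Implicit.
Unset Printing Implicit Defensive.

Import Order.TTheory GRing.Theory Num.Theory.

Local Open Scope classical_set_scope.
Local Open Scope card_scope.
Local Open Scope ring_scope.

(* Totalised with the value 0 when there is no minimum (resp. maximum), i.e.,
   when S is empty (resp. empty or unbounded). *)
Definition nat_min (S : set nat) : nat := xget 0%N (S `&` lbound S).
Definition nat_max (S : set nat) : nat := xget 0%N (S `&` ubound S).

Section NonnegativeRank.
Variable R : realType.

Definition nonneg_mx m n (A : 'M[R]_(m, n)) : Prop := forall i j, 0 <= A i j.

(* For a nonnegative M the sets of admissible k are nonempty: for both ranks
   the factorization M *m 1%:M shows that n is admissible. *)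
Definition nnrank m n (M : 'M[R]_(m, n)) : nat :=
  nat_min [set k | exists (U : 'M[R]_(m, k)) (V : 'M[R]_(k, n)),
    [/\ nonneg_mx U, nonneg_mx V & M = U *m V]].

Definition restricted_nnrank m n (M : 'M[R]_(m, n)) : nat :=
  nat_min [set k | exists (U : 'M[R]_(m, k)) (V : 'M[R]_(k, n)),
    [/\ nonneg_mx U, nonneg_mx V, M = U *m V & \rank U = \rank M]].

End NonnegativeRank.

(* Points of R^D are row vectors; a finite family of k points is given by the
   rows of a k x D matrix. *)
Section Polytopes.
Variable R : realType.

Definition conv_rows k D (V : 'M[R]_(k, D)) : set 'rV[R]_D :=
  [set x | exists t : 'rV[R]_k,
    [/\ nonneg_mx t, \sum_i t 0 i = 1 & x = t *m V]].

Definition polytope D (P : set 'rV[R]_D) : Prop :=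
  exists k (V : 'M[R]_(k, D)), P = conv_rows V.

Definition affine_hull D (S : set 'rV[R]_D) : set 'rV[R]_D :=
  [set x | exists k (V : 'M[R]_(k, D)) (t : 'rV[R]_k),
    [/\ forall i, S (row i V), \sum_i t 0 i = 1 & x = t *m V]].

(* The affine hull of S is a translate of a d-dimensional linear subspace (the
   row space of W). No natural number d is a dimension of set0. *)
Definition has_dim D (S : set 'rV[R]_D) (d : nat) : Prop :=
  exists (x : 'rV[R]_D) (W : 'M[R]_D),
    \rank W = d /\ affine_hull S = [set x + w | w in [set w | (w <= W)%MS]].

(* The intersection of P with the equality set of a linear inequality valid on
   P. The inequality 0 <= 0 makes P a face of itself. *)
Definition face D (P F : set 'rV[R]_D) : Prop :=
  exists (c : 'cV[R]_D) (b : R),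
    (forall x, P x -> (x *m c) 0 0 <= b) /\
    F = P `&` [set x | (x *m c) 0 0 = b].

Definition kfaces D (P : set 'rV[R]_D) (k : nat) : set (set 'rV[R]_D) :=
  [set F | face P F /\ has_dim F k].

(* The vertices of a polytope are its 0-faces. A face is the convex hull of the
   vertices it contains, so a polytope with n vertices has at most 2 ^ n faces:
   the set below is bounded. *)
Definition max_faces (n d k : nat) : nat :=
  nat_max [set N | exists D (P : set 'rV[R]_D),
    [/\ polytope P, has_dim P d, kfaces P 0 #= `I_n & kfaces P k #= `I_N]].

End Polytopes.

(* Main.v *)
(* Take a factorization M = U V of minimal size p = rank_+ M. By minimality the
   columns of U, rescaled to have coordinate sum 1, are the p vertices of a
   polytope P of dimension r_u - 1, where r_u = rank U; let C be the cone over P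
   and L the column space of M, of dimension r. Each extreme ray of C ∩ L spans
   the intersection of L with the linear span of some face of P. As long as the
   span of that face has dimension at most r_u - r, the face can be enlarged by
   one dimension without enlarging this intersection, because the faces one
   dimension higher do not all lie in (span of the face) + L. So every extreme ray
   is determined by an (r_u - r)-face of P, and one vector of C ∩ L for each such
   face gives a factorization of M of restricted type. *)

Require Import Defs.
From mathcomp Require Import all_boot all_order all_algebra.
From mathcomp Require Import all_classical all_reals.
From mathcomp Require Import ring zify.

Set Implicit Arguments.
Unset Strict Implicit.
Unset Printing Implicit Defensive.

Import Order.TTheory GRing.Theory Num.Theory.

Local Open Scope ring_scope.

(** * Pairing of row vectors with linear functionals *)

Definition dot (R : pzRingType) m (x : 'rV[R]_m) (c : 'cV[R]_m) : R :=
  (x *m c) 0 0.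

Section Dot.
Variables (R : comPzRingType) (m : nat).
Implicit Types (x y : 'rV[R]_m) (c d : 'cV[R]_m).

Lemma dotDl x y c : dot (x + y) c = dot x c + dot y c.
Proof. by rewrite /dot mulmxDl mxE. Qed.

Lemma dotDr x c d : dot x (c + d) = dot x c + dot x d.
Proof. by rewrite /dot mulmxDr mxE. Qed.

Lemma dotNl x c : dot (- x) c = - dot x c.
Proof. by rewrite /dot mulNmx mxE. Qed.

Lemma dotNr x c : dot x (- c) = - dot x c.
Proof. by rewrite /dot mulmxN mxE. Qed.

Lemma dotZl a x c : dot (a *: x) c = a * dot x c.
Proof. by rewrite /dot -scalemxAl mxE. Qed.

Lemma dotZr a x c : dot x (a *: c) = a * dot x c.
Proof. by rewrite /dot -scalemxAr mxE. Qed.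

Lemma dot0l c : dot 0 c = 0.
Proof. by rewrite /dot mul0mx mxE. Qed.

Lemma dot0r x : dot x 0 = 0.
Proof. by rewrite /dot mulmx0 mxE. Qed.

Lemma dot_suml (I : Type) (r : seq I) (P : pred I) (F : I -> 'rV[R]_m) c :
  dot (\sum_(i <- r | P i) F i) c = \sum_(i <- r | P i) dot (F i) c.
Proof. by rewrite /dot mulmx_suml summxE. Qed.

Lemma dot_sumr (I : Type) (r : seq I) (P : pred I) x (F : I -> 'cV[R]_m) :
  dot x (\sum_(i <- r | P i) F i) = \sum_(i <- r | P i) dot x (F i).
Proof. by rewrite /dot mulmx_sumr summxE. Qed.

End Dot.

(** * Finitely generated cones *)

Section Cones.
Variables (R : realFieldType) (m : nat).
Implicit Types (x y : 'rV[R]_m) (c d h : 'cV[R]_m).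

Definition cone (I : finType) (g : I -> 'rV[R]_m) (J : {set I}) x : Prop :=
  exists2 t : I -> R, (forall i, 0 <= t i) & x = \sum_(i in J) t i *: g i.

(** Redundancy is tested by index: a repeated generator is redundant, and so is a zero generator. *)
Definition irredundant (I : finType) (g : I -> 'rV[R]_m) (J : {set I}) : Prop :=
  forall i, i \in J -> ~ cone g (J :\ i) (g i).

(** The index sets of the generators lying on a face of the cone, cut out by a supporting
    hyperplane; [c = 0] gives the whole family. *)
Definition exposed (I : finType) (g : I -> 'rV[R]_m) (S : {set I}) : Prop :=
  exists c, forall i, dot (g i) c <= 0 /\ (i \in S) = (dot (g i) c == 0).

Definition span (I : finType) (g : I -> 'rV[R]_m) (S : {set I}) : 'M[R]_m :=
  (\sum_(i in S) <<g i>>)%MS.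

Section Family.
Variables (I : finType) (g : I -> 'rV[R]_m).
Implicit Types (J S : {set I}).

Lemma cone0 J : cone g J 0.
Proof.
exists (fun=> 0) => //; rewrite big1 // => i _; by rewrite scale0r.
Qed.

Lemma coneD J x y : cone g J x -> cone g J y -> cone g J (x + y).
Proof.
move=> [t t0 ->] [s s0 ->]; exists (fun i => t i + s i) => [i|].
  exact: addr_ge0.
by rewrite -big_split; apply: eq_bigr => i _; rewrite scalerDl.
Qed.

Lemma coneZ J a x : 0 <= a -> cone g J x -> cone g J (a *: x).
Proof.
move=> a0 [t t0 ->]; exists (fun i => a * t i) => [i|].
  exact: mulr_ge0.
by rewrite scaler_sumr; apply: eq_bigr => i _; rewrite scalerA.
Qed.

Lemma cone_gen J i : i \in J -> cone g J (g i).
Proof.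
move=> iJ; exists (fun j => (j == i)%:R) => //.
rewrite (bigD1 i) //= eqxx scale1r big1 ?addr0 // => j /andP[_ /negPf ->].
by rewrite scale0r.
Qed.

Lemma cone_sum (K : Type) (r : seq K) (P : pred K) (F : K -> 'rV[R]_m) J :
  (forall k, P k -> cone g J (F k)) -> cone g J (\sum_(k <- r | P k) F k).
Proof. by move=> H; apply: big_ind => //; [exact: cone0|exact: coneD]. Qed.

Lemma coneS J S x : J \subset S -> cone g J x -> cone g S x.
Proof.
move=> /fintype.subsetP JS [t t0 ->]; apply: cone_sum => i iJ.
by apply: coneZ => //; apply/cone_gen/JS.
Qed.

Lemma cone_span J x : cone g J x -> (x <= span g J)%MS.
Proof.
move=> [t _ ->]; apply: summx_sub => i iJ; apply: scalemx_sub.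
by apply: (sumsmx_sup i) => //; rewrite genmxE.
Qed.

Lemma spanP J x :
  reflect (exists u : I -> R, x = \sum_(i in J) u i *: g i) (x <= span g J)%MS.
Proof.
apply: (iffP idP) => [/sub_sumsmxP[u ->]|[u ->]].
  have H i : exists a, u i *m <<g i>>%MS == a *: g i.
    have /sub_rVP[a ->] : (u i *m <<g i>>%MS <= g i)%MS.
      by have := submxMl (u i) <<g i>>%MS; rewrite genmxE.
    by exists a.
  exists (fun i => xchoose (H i)); apply: eq_bigr => i _.
  exact/eqP/(xchooseP (H i)).
apply: summx_sub => i iJ; apply: scalemx_sub.
by apply: (sumsmx_sup i) => //; rewrite genmxE.
Qed.

Lemma cone_dot_le0 J c x :
  (forall i, i \in J -> dot (g i) c <= 0) -> cone g J x -> dot x c <= 0.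
Proof.
move=> gc [t t0 ->]; rewrite dot_suml sumr_le0 // => i iJ.
by rewrite dotZl mulr_ge0_le0 ?gc.
Qed.

Lemma cone_dot_ge0 J c x :
  (forall i, i \in J -> 0 <= dot (g i) c) -> cone g J x -> 0 <= dot x c.
Proof.
move=> gc [t t0 ->]; rewrite dot_suml sumr_ge0 // => i iJ.
by rewrite dotZl mulr_ge0 ?gc.
Qed.

(** Complementary slackness: a vanishing sum of nonpositive terms has only zero terms. *)
Lemma sum_dot_eq0 J c (t : I -> R) : (forall i, 0 <= t i) ->
  (forall i, i \in J -> dot (g i) c <= 0) ->
  dot (\sum_(i in J) t i *: g i) c = 0 ->
  forall i, i \in J -> dot (g i) c != 0 -> t i = 0.
Proof.
move=> t0 gc; rewrite dot_suml => s0 i iJ gi0.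
have /eqP := s0; rewrite -oppr_eq0 -sumrN psumr_eq0; last first.
  by move=> j jJ; rewrite dotZl oppr_ge0 mulr_ge0_le0 ?gc.
move=> /allP/(_ i (mem_index_enum i)); rewrite iJ /= dotZl oppr_eq0 mulf_eq0.
by rewrite (negPf gi0) orbF => /eqP.
Qed.

(** Pointedness: a functional positive on the generators detects every nonzero point of the cone. *)
Lemma cone_dot_eq0 J h x : (forall i, i \in J -> 0 < dot (g i) h) ->
  cone g J x -> dot x h = 0 -> x = 0.
Proof.
move=> gh [t t0 ->] s0; rewrite big1 // => i iJ.
rewrite (@sum_dot_eq0 J (- h) t) ?scale0r // => [j jJ||].
- by rewrite dotNr oppr_le0 ltW ?gh.
- by rewrite dotNr s0 oppr0.
- by rewrite dotNr oppr_eq0 gt_eqF ?gh.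
Qed.

(** Generators in the cone of the others are discarded one at a time; the cardinality of [J] bounds
    the number of removals. *)
Lemma irredundant_subset J : exists J', [/\ J' \subset J, irredundant g J' &
  forall x, cone g J x -> cone g J' x].
Proof.
elim: {J}#|J| {-2}J (leqnn #|J|) => [|n IH] J.
  rewrite leqn0 cards_eq0 => /eqP ->; exists finset.set0; split=> // i.
  by rewrite inE.
move=> Jn; have [irr|] := pselect (irredundant g J); first by exists J.
move=> /existsNP[i] /not_implyP[iJ /contrapT gi].
have [|J' [J'J irr gen]] := IH (J :\ i).
  by move: Jn; rewrite (cardsD1 i) iJ ltnS.
exists J'; split=> // [|x [t t0 ->]].
  exact: fintype.subset_trans J'J (finset.subsetDl _ _).
apply: cone_sum => j jJ; apply: coneZ => //; apply: gen.
by have [->//|ji] := eqVneq j i; apply: cone_gen; rewrite !inE ji.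
Qed.

End Family.

Lemma cone_trans (I K : finType) (g : I -> 'rV[R]_m) (f : K -> 'rV[R]_m)
    (J : {set I}) (T : {set K}) x :
  (forall k, k \in T -> cone g J (f k)) -> cone f T x -> cone g J x.
Proof. by move=> H [t t0 ->]; apply: cone_sum => k /H; exact: coneZ. Qed.

(** Induction on the number of generators. If the functional [c] separating [x] from the cone
    without [a] is positive at [g a], everything is projected along [g a] onto the kernel of [c],
    and the induction hypothesis is applied to the projections. *)
Lemma farkas (I : finType) (g : I -> 'rV[R]_m) (J : {set I}) x :
  cone g J x \/
  exists2 c, (forall i, i \in J -> dot (g i) c <= 0) & 0 < dot x c.
Proof.
elim: {J}#|J| {-2}J (erefl #|J|) g x => [|n IH] J.
  move=> /eqP; rewrite cards_eq0 => /eqP -> g x.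
  have [->|x0] := eqVneq x 0; first by left; exact: cone0.
  (* The pairing of [x] with its transpose is the sum of the squares of its coordinates. *)
  right; exists x^T => [i|]; first by rewrite inE.
  have xx j : 0 <= x 0 j * x^T j 0 by rewrite mxE -expr2 sqr_ge0.
  rewrite lt_def /dot mxE sumr_ge0 // andbT.
  apply: contra x0 => /eqP s0; apply/eqP/rowP => j; rewrite mxE.
  have /eqP := psumr_eq0P (fun j _ => xx j) s0 (i := j) isT.
  by rewrite mxE mulf_eq0 orbb => /eqP.
move=> Jn g x.
have /card_gt0P[a aJ] : (0 < #|J|)%N by rewrite Jn.
have Jan : #|J :\ a| = n by move: Jn; rewrite (cardsD1 a) aJ => -[].
have [xJ|[c gc xc]] := IH _ Jan g x.
  by left; apply: coneS xJ; exact: finset.subsetDl.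
have [ac|ac] := leP (dot (g a) c) 0.
  right; exists c => // i iJ; have [->//|ia] := eqVneq i a.
  by rewrite gc // !inE ia.
pose pr y := y - (dot y c / dot (g a) c) *: g a.
have [[t t0 xE]|[d gd xd]] := IH _ Jan (pr \o g) (pr x).
  left; have -> : x = (dot x c / dot (g a) c) *: g a + pr x by rewrite addrC subrK.
  rewrite xE.
  under eq_bigr do rewrite /= /pr scalerBr scalerA.
  rewrite sumrB -scaler_suml addrCA -scalerBl.
  apply: coneD.
    apply: cone_sum => i; rewrite !inE => /andP[_ iJ].
    by apply: coneZ => //; exact: cone_gen.
  apply: coneZ; last exact: cone_gen.
  (* Undoing the projection leaves a coefficient on [g a] that is nonnegative, because [c] is
     positive at [x] and at [g a] and nonpositive on the other generators. *)
  rewrite subr_ge0 (@le_trans _ _ 0) //; last first.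
    by rewrite divr_ge0 // ltW.
  apply: sumr_le0 => i iJ; rewrite mulr_ge0_le0 // mulr_le0_ge0 ?gc //.
  by rewrite invr_ge0 ltW.
(* The adjoint of [pr] pulls [d] back to a functional that vanishes at [g a]. *)
have prE y : dot y (d - (dot (g a) d / dot (g a) c) *: c) = dot (pr y) d.
  by rewrite dotDr dotNr dotZr dotDl dotNl dotZl; congr (_ - _); ring.
right; exists (d - (dot (g a) d / dot (g a) c) *: c); last by rewrite prE.
move=> i iJ; have [->|ia] := eqVneq i a.
  by rewrite dotDr dotNr dotZr divfK ?gt_eqF // subrr.
by rewrite prE gd // !inE ia.
Qed.

(* Farkas' lemma for the target [- g l] and the family in which [- x] replaces
   [g l]. *)
Lemma farkas_swap (I : finType) (g : I -> 'rV[R]_m) (J : {set I}) l x :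
  l \in J ->
  (exists2 t : I -> R, (forall i, 0 <= t i) &
     t l *: x = g l + \sum_(i in J :\ l) t i *: g i) \/
  (exists c, [/\ forall i, i \in J :\ l -> dot (g i) c <= 0,
     0 <= dot x c & dot (g l) c < 0]).
Proof.
move=> lJ; have [[t t0 tE]|[c gc lc]] :=
  farkas (fun i => if i == l then - x else g i) J (- g l).
  left; exists t => //; move: tE; rewrite (bigD1 l) //= eqxx => tE.
  have -> : \sum_(i in J :\ l) t i *: g i =
      \sum_(i in J | i != l) t i *: (if i == l then - x else g i).
    apply: eq_big => [i|i]; first by rewrite !inE andbC.
    by rewrite !inE => /andP[/negPf ->].
  have -> : g l = - (- g l) by rewrite opprK.
  by rewrite tE scalerN opprD opprK -addrA addNr addr0.
right; exists c; split.
- by move=> i; rewrite !inE => /andP[/negPf il /gc]; rewrite il.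
- by have := gc l lJ; rewrite eqxx dotNl oppr_le0.
- by rewrite -oppr_gt0 -dotNl.
Qed.

(** For each other generator [l] there is a functional vanishing at [g i], nonpositive on the rest
    and negative at [g l]; the sum over [l] is negative on all of them. *)
Lemma irredundant_exposed (I : finType) (g : I -> 'rV[R]_m) (J : {set I}) h i :
  irredundant g J -> (forall j, j \in J -> 0 < dot (g j) h) -> i \in J ->
  exists2 c, dot (g i) c = 0 & forall j, j \in J :\ i -> dot (g j) c < 0.
Proof.
move=> irr gh iJ.
have H l : exists c, l \in J :\ i -> [/\ dot (g i) c = 0,
    forall j, j \in J :\ i -> dot (g j) c <= 0 & dot (g l) c < 0].
  have [|_] := boolP (l \in J :\ i); last by exists 0.
  rewrite !inE => /andP[li lJ].
  have iJl : i \in J :\ l by rewrite !inE eq_sym li.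
  have [[t t0 tE]|[c [gc ic lc]]] := farkas_swap g (g i) lJ.
    (* Moving the term of [g i] to the left leaves a multiple of [g i] in the cone of the others.
       The functional [h] forces the factor to be positive, so [g i] would be redundant. *)
    have := tE; rewrite (bigD1 i) //= addrCA => /(congr1 (fun v => v - t i *: g i)).
    rewrite addrAC subrr add0r -scalerBl => {}tE; exfalso.
    set z := \sum_(_ in _ | _) _ in tE.
    have zc : cone g (J :\ i) (g l + z).
      apply: coneD; first by apply: cone_gen; rewrite !inE li.
      apply: cone_sum => k; rewrite !inE => /andP[/andP[_ kJ] ki].
      by apply: coneZ => //; apply: cone_gen; rewrite !inE ki.
    have tl : 0 < t l - t i.
      rewrite -(pmulr_lgt0 _ (gh _ iJ)) -dotZl tE dotDl ltr_pwDl ?gh //.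
      rewrite /z dot_suml sumr_ge0 // => k; rewrite !inE => /andP[/andP[_ kJ] _].
      by rewrite dotZl mulr_ge0 // ltW ?gh.
    apply: (irr i iJ); have -> : g i = (t l - t i)^-1 *: (g l + z).
      by rewrite -tE scalerA mulVf ?scale1r ?gt_eqF.
    by apply: coneZ => //; rewrite invr_ge0 ltW.
  exists c => _; split=> //.
    by apply/eqP; rewrite eq_le ic gc.
  move=> j; rewrite !inE => /andP[ji jJ].
  by have [->|jl] := eqVneq j l; [exact: ltW|apply: gc; rewrite !inE jl].
have /choice[c Hc] := H; exists (\sum_(l in J :\ i) c l) => [|j jJ].
  by rewrite dot_sumr big1 // => l /Hc[].
rewrite dot_sumr (bigD1 j) //= -[ltRHS]addr0 ltr_leD //.
  by have [] := Hc j jJ.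
by apply: sumr_le0 => l /andP[/Hc[_ + _] _]; apply.
Qed.

(* S consists of the indices that occur with a positive coefficient in some
   conical representation of x; for any other index, Farkas' lemma gives a
   functional vanishing at x and negative on that generator. *)
Lemma relint_of_exposed (I : finType) (g : I -> 'rV[R]_m) h x :
  (forall i, 0 < dot (g i) h) -> cone g [set: I] x ->
  exists (S : {set I}) (s : I -> R),
  [/\ exposed g S, forall i, i \in S -> 0 < s i & x = \sum_(i in S) s i *: g i].
Proof.
move=> gh [t t0 xE].
pose rep i (s : I -> R) := [/\ forall j, 0 <= s j, 0 < s i &
  x = \sum_(j in [set: I]) s j *: g j].
pose S : {set I} := [set i | `[< exists s, rep i s >]]%SET.
have /choice[u Hu] i : exists s, i \in S -> rep i s.
  have [|_] := boolP (i \in S); last by exists (fun=> 0).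
  by rewrite inE => /asboolP[s Hs]; exists s.
have xh : 0 <= dot x h.
  by rewrite xE dot_suml sumr_ge0 // => i _; rewrite dotZl mulr_ge0 // ltW.
have /choice[c Hc] i : exists c, i \notin S ->
    [/\ forall j, dot (g j) c <= 0, dot x c = 0 & dot (g i) c < 0].
  have [|iS] := boolP (i \in S); first by exists 0.
  (* The first alternative represents a multiple of [x] with coefficient 1 on [g i]. By [h] the
     factor is positive, and dividing by it would put [i] in [S]. *)
  have [[s s0 sE]|[c [gc xc ic]]] := farkas_swap g x (finset.in_setT i).
    have si : 0 < s i.
      rewrite lt_def s0 andbT; apply/eqP => si.
      have : 0 < dot (s i *: x) h.
        rewrite sE dotDl ltr_pwDl // dot_suml sumr_ge0 // => j _.
        by rewrite dotZl mulr_ge0 // ltW.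
      by rewrite si scale0r dot0l ltxx.
    case/negP: iS; rewrite inE; apply/asboolP.
    exists (fun j => (s i)^-1 * (if j == i then 1 else s j)); split.
    - by move=> j; rewrite mulr_ge0 ?invr_ge0 //; case: eqP.
    - by rewrite eqxx mulr1 invr_gt0.
    have -> : x = (s i)^-1 *: (s i *: x) by rewrite scalerA mulVf ?scale1r ?gt_eqF.
    rewrite sE [RHS](bigD1 i) //= eqxx mulr1 scalerDr; congr (_ + _).
    rewrite scaler_sumr; apply: eq_big => [j|j]; first by rewrite !inE andbT.
    by rewrite !inE => /andP[/negPf -> _]; rewrite scalerA.
  have gc' j : dot (g j) c <= 0.
    have [->|ji] := eqVneq j i; first exact: ltW.
    by apply: gc; rewrite !inE ji.
  exists c => _; split=> //; apply/eqP; rewrite eq_le xc andbT xE.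
  by rewrite dot_suml sumr_le0 // => j _; rewrite dotZl mulr_ge0_le0.
pose C := \sum_(i in ~: S) c i.
have gC j : dot (g j) C <= 0.
  by rewrite dot_sumr sumr_le0 // => i; rewrite inE => /Hc[].
have xC : dot x C = 0.
  by rewrite dot_sumr big1 // => i; rewrite inE => /Hc[].
have nS i : i \notin S -> dot (g i) C < 0.
  move=> iS; have iS' : i \in ~: S by rewrite inE.
  rewrite dot_sumr (bigD1 i) //= -[ltRHS]addr0 ltr_leD //.
    by have [] := Hc i iS.
  by apply: sumr_le0 => l /andP[]; rewrite inE => /Hc[+ _ _] _; apply.
have expS : exposed g S.
  exists C => i; split=> //; have [iS|/nS iS] := boolP (i \in S); last first.
    by rewrite lt_eqF.
  apply/esym/negPn/negP => giC; have [s0 si sE] := Hu i iS.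
  move: xC; rewrite {1}sE => xC.
  have := @sum_dot_eq0 I g [set: I] C (u i) s0 (fun j _ => gC j) xC i
    (finset.in_setT i) giC.
  by move: si => /[swap] ->; rewrite ltxx.
have notS s : (forall i, 0 <= s i) -> x = \sum_(j in [set: I]) s j *: g j ->
    forall i, i \notin S -> s i = 0.
  move=> s0 sE i iS; apply/eqP; apply: contraNT iS => si.
  by rewrite inE; apply/asboolP; exists s; split=> //; rewrite lt_def si s0.
(* Averaging [t] with all witnesses [u i] gives a representation of [x] that is positive exactly on
   [S]. Including [t] keeps the divisor [1 + #|S|] positive even when [S] is empty. *)
pose w j := t j + \sum_(i in S) u i j.
have w_gt0 j : j \in S -> 0 < w j.
  move=> jS; rewrite /w (bigD1 j) //= addrCA ltr_pwDl //.
    by have [] := Hu j jS.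
  rewrite addr_ge0 // sumr_ge0 // => i /andP[/Hu[+ _ _] _]; exact.
have wE : \sum_(j in S) w j *: g j = (1 + #|S|%:R) *: x.
  have -> : \sum_(j in S) w j *: g j = \sum_(j in [set: I]) w j *: g j.
    rewrite [RHS](bigID [in S]) /= [X in _ = _ + X]big1 ?addr0; last first.
      move=> j /andP[_ jS]; rewrite /w (notS t) // big1 ?addr0 ?scale0r // => i.
      by move=> /Hu[u0 _ uE]; exact: (notS (u i)).
    by apply: eq_bigl => j; rewrite finset.in_setT.
  rewrite scalerDl scale1r {1}xE.
  under eq_bigr do rewrite scalerDl scaler_suml.
  rewrite big_split /= exchange_big /=; congr (_ + _).
  rewrite scaler_nat -sumr_const; apply: eq_bigr => i /Hu[_ _ uE].
  by rewrite -uE.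
have S1 : 0 < 1 + #|S|%:R :> R by rewrite ltr_pwDl.
exists S, (fun j => (1 + #|S|%:R)^-1 * w j); split=> //.
  by move=> i /w_gt0 wi; rewrite mulr_gt0 ?invr_gt0.
under eq_bigr do rewrite -scalerA.
by rewrite -scaler_sumr wE scalerA mulVf ?scale1r ?gt_eqF.
Qed.

(* One point of the slice for each support suffices: subtracting its largest
   possible multiple from a point with the same support shrinks the support. *)
Lemma cone_cap_finite (I : finType) (g : I -> 'rV[R]_m) n (L : 'M[R]_(n, m)) :
  exists e : {set I} -> 'rV[R]_m,
  (forall J, cone g [set: I] (e J) /\ (e J <= L)%MS) /\
  (forall x, cone g [set: I] x -> (x <= L)%MS -> cone e [set: {set I}] x).
Proof.
pose comb (u : I -> R) := \sum_(i in [set: I]) u i *: g i.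
pose P (J : {set I}) u := [/\ forall i, 0 <= u i, (comb u <= L)%MS &
  forall i, (i \in J) = (u i != 0)].
have /choice[u Hu] (J : {set I}) : exists u, [/\ forall i, 0 <= u i,
    (comb u <= L)%MS & (exists v, P J v) -> P J u].
  have [[v Pv]|nP] := pselect (exists v, P J v).
    by exists v; split=> //; case: Pv.
  exists (fun=> 0); split=> //; rewrite /comb big1 ?sub0mx // => i _.
  by rewrite scale0r.
exists (comb \o u); split=> [J|x [t t0 ->] tL].
  by have [uJ uL _] := Hu J; split=> //; exists (u J).
rewrite -/(comb t) in tL *; pose supp (t : I -> R) : {set I} := [set i | t i != 0]%SET.
elim: {t}#|supp t| {-2}t (leqnn #|supp t|) t0 tL => [|N IH] t tN t0 tL.
  rewrite /comb big1 => [|i _]; first exact: cone0.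
  have : i \notin supp t by move: tN; rewrite leqn0 cards_eq0 => /eqP ->; rewrite inE.
  by rewrite inE negbK => /eqP ->; rewrite scale0r.
have [supp0|[i0 i0J]] := set_0Vmem (supp t).
  by apply: IH => //; rewrite supp0 cards0.
have [|u0 uL uE] := (let: And3 _ _ H := Hu (supp t) in H).
  by exists t; split=> // i; rewrite inE.
(* The least ratio is the largest multiple that can be subtracted while keeping the coefficients
   nonnegative; its index leaves the support. *)
case: (arg_minP (fun i => t i / u (supp t) i) i0J) => i iJ imin.
set a := t i / u (supp t) i in imin.
have a0 : 0 <= a by rewrite divr_ge0.
pose t' j := t j - a * u (supp t) j.
have t'0 j : 0 <= t' j.
  rewrite subr_ge0; have [jJ|] := boolP (j \in supp t); last first.
    by rewrite uE negbK => /eqP ->; rewrite mulr0.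
  have uj : 0 < u (supp t) j by rewrite lt_def u0 -uE jJ.
  by rewrite -ler_pdivlMr // imin.
have combt : comb t = a *: comb (u (supp t)) + comb t'.
  rewrite /comb scaler_sumr -big_split; apply: eq_bigr => j _ /=.
  by rewrite scalerA -scalerDl addrC subrK.
have t'L : (comb t' <= L)%MS.
  have -> : comb t' = comb t - a *: comb (u (supp t)).
    by rewrite combt addrC addKr.
  by rewrite addmx_sub // eqmx_opp scalemx_sub.
rewrite combt; apply: coneD.
  by apply: coneZ => //; exact: (cone_gen (comb \o u) (finset.in_setT (supp t))).
apply: IH => //; rewrite -ltnS; apply: leq_trans tN; apply: proper_card.
apply/fintype.properP; split.
  apply/fintype.subsetP => j; apply: contraLR => jJ.
  have uj : u (supp t) j = 0 by move: jJ; rewrite uE negbK => /eqP.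
  by move: jJ; rewrite !inE /t' uj mulr0 subr0.
exists i => //; rewrite inE negbK /t' /a divfK ?subrr //.
by rewrite -uE.
Qed.

Lemma cone_split (I : finType) (g : I -> 'rV[R]_m) (J : {set I}) k x :
  cone g J x -> k \in J ->
  exists a z, [/\ 0 <= a, cone g (J :\ k) z & x = a *: g k + z].
Proof.
move=> [t t0 ->] kJ; exists (t k), (\sum_(i in J :\ k) t i *: g i).
split=> //; first by exists t.
by rewrite (bigD1 k) //=; congr (_ + _); apply: eq_bigl => i; rewrite !inE andbC.
Qed.

(** The inverse of a number [C] exceeding every ratio of [|u i|] to [s i] serves as the step; the
    summand 1 keeps [C] positive when [u] vanishes. *)
Lemma step_size (I : finType) (S : {set I}) (s u : I -> R) :
  (forall i, i \in S -> 0 < s i) ->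
  exists2 e, 0 < e & forall i, i \in S -> e * `|u i| <= s i.
Proof.
move=> s0; pose C := 1 + \sum_(i in S) `|u i| / s i.
have uS i : i \in S -> 0 <= `|u i| / s i.
  by move=> iS; rewrite divr_ge0 // ltW ?s0.
have C0 : 0 < C by rewrite ltr_pwDl // sumr_ge0.
exists C^-1 => [|i iS]; first by rewrite invr_gt0.
rewrite mulrC ler_pdivrMr // mulrC -ler_pdivrMr ?s0 // /C (bigD1 i) //=.
by rewrite addrCA lerDl addr_ge0 // sumr_ge0 // => j /andP[/uS].
Qed.

(* [e k] is a positive combination of [S], so it can be moved both ways along any
   direction of [span g S :&: L] without leaving the slice. *)
Lemma irredundant_extremal (I K : finType) (g : I -> 'rV[R]_m)
    (e : K -> 'rV[R]_m) (T : {set K}) n (L : 'M[R]_(n, m)) h k :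
  (forall i, 0 < dot (g i) h) ->
  (forall k, k \in T -> cone g [set: I] (e k) /\ (e k <= L)%MS) ->
  (forall x, cone g [set: I] x -> (x <= L)%MS -> cone e T x) ->
  irredundant e T -> k \in T ->
  exists S : {set I}, [/\ exposed g S, e k != 0, (e k <= span g S)%MS &
    (span g S :&: L <= e k)%MS].
Proof.
move=> gh eC genC irr kT.
have [S [s [expS s0 kE]]] := relint_of_exposed gh (proj1 (eC k kT)).
have ek0 : e k != 0.
  by apply/eqP => ek0; apply: (irr k kT); rewrite ek0; exact: cone0.
exists S; split=> //; first by apply/spanP; exists s.
apply/row_subP => r; set y := row r _.
have : (y <= span g S :&: L)%MS by rewrite row_sub.
rewrite sub_capmx => /andP[/spanP[u yE] yL].
have [a a0 aS] := step_size u s0.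
have move_in b : `|b| = a -> cone g [set: I] (e k + b *: y) /\
    ((e k + b *: y)%R <= L)%MS.
  move=> ba; split; last first.
    by rewrite addmx_sub ?scalemx_sub // (proj2 (eC k kT)).
  rewrite kE yE scaler_sumr -big_split; apply: cone_sum => i iS /=.
  rewrite scalerA -scalerDl; apply: coneZ; last exact: cone_gen.
  rewrite -[b * _]opprK subr_ge0; apply: le_trans (aS i iS).
  by rewrite -ba -normrM -normrN ler_norm.
have [xC xL] := move_in a (gtr0_norm a0).
have [x'C x'L] := move_in (- a) (etrans (normrN _) (gtr0_norm a0)).
have [b [z [b0 zC xE]]] := cone_split (genC _ xC xL) kT.
have [b' [z' [b'0 z'C x'E]]] := cone_split (genC _ x'C x'L) kT.
(* Adding the decompositions of the two opposite displacements cancels [y] and leaves generator [k]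
   only on the left. *)
have zz' : (2 - (b + b')) *: e k = z + z'.
  apply: (addrI ((b + b') *: e k)); rewrite -scalerDl [in LHS]addrC subrK.
  rewrite [in RHS]scalerDl addrACA -xE -x'E scaleNr addrACA subrr addr0.
  by rewrite scaler_nat mulr2n.
have ehT x : cone e (T :\ k) x -> cone g [set: I] x.
  by apply: cone_trans => j; rewrite !inE => /andP[_ /eC[]].
have pos x : cone g [set: I] x -> 0 <= dot x h.
  by apply: cone_dot_ge0 => i _; exact: ltW.
have [lt2|ge2] := ltP (b + b') 2.
  exfalso; apply: (irr k kT).
  have -> : e k = (2 - (b + b'))^-1 *: (z + z').
    by rewrite -zz' scalerA mulVf ?scale1r // gt_eqF // subr_gt0.
  apply: coneZ; last exact: coneD.
  by rewrite invr_ge0 subr_ge0 ltW.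
(* Now [h] is nonpositive on the left of [zz'] and nonnegative on [z] and [z'], so [z] vanishes and
   the first displacement is a multiple of [e k]. *)
have z0 : dot z h = 0.
  apply/eqP; rewrite eq_le (pos z) ?andbT; last exact: ehT.
  have := congr1 (fun v => dot v h) zz'; rewrite dotZl dotDl => zzh.
  have : dot z h + dot z' h <= 0.
    rewrite -zzh mulr_le0_ge0 ?subr_le0 //; apply: pos; exact: proj1 (eC k kT).
  by apply: le_trans; rewrite lerDl; apply/pos/ehT.
have {}z0 : z = 0.
  by apply: (@cone_dot_eq0 _ _ [set: I] h) z0; [move=> i _; exact: gh|exact: ehT].
have yk : a *: y = (b - 1) *: e k.
  by rewrite scalerBl scale1r; apply: (addrI (e k)); rewrite xE z0 addr0 addrC subrK.
have -> : y = (a^-1 * (b - 1)) *: e k.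
  by rewrite -scalerA -yk scalerA mulVf ?scale1r ?gt_eqF.
exact: scalemx_sub.
Qed.

(* The generators outside [span g S] that are irredundant modulo [span g S] give
   the exposed families covering [S]; they cannot all lie in [span g S + L]. *)
Lemma exposed_extend (I : finType) (g : I -> 'rV[R]_m) n (L : 'M[R]_(n, m))
    (S : {set I}) :
  exposed g S -> ~~ (span g [set: I] <= span g S + L)%MS ->
  exists S' : {set I}, [/\ exposed g S', S \subset S',
    \rank (span g S') = (\rank (span g S)).+1 &
    (span g S' :&: L <= span g S)%MS].
Proof.
move=> [d gd] nSL; set W := span g S; pose Q := proj_mx (W^C)%MS W.
(* [Q] is a projection with kernel [W]: it models the quotient by [W], in which the images [b i] of
   the generators outside [S] span a pointed cone. *)
have gW i : i \in S -> (g i <= W)%MS by move=> iS; exact/cone_span/cone_gen.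
have QW (x : 'rV[R]_m) : (x - x *m Q <= W)%MS.
  by apply: proj_mx_compl_sub; rewrite addsmxC submx_full // addsmx_compl_full.
have WQ (x : 'rV[R]_m) : (x <= W)%MS -> x *m Q = 0.
  by move=> xW; apply: proj_mx_0 xW; rewrite capmxC capmx_compl.
have Wd x : (x <= W)%MS -> dot x d = 0.
  move=> /spanP[u ->]; rewrite dot_suml big1 // => i iS; rewrite dotZl.
  by move: iS; rewrite (proj2 (gd i)) => /eqP ->; rewrite mulr0.
pose b i := g i *m Q.
have gbW i : (g i - b i <= W)%MS by exact: QW.
have bd i : dot (b i) d = dot (g i) d.
  by apply/esym/eqP; rewrite -subr_eq0 -dotNl -dotDl Wd.
have [J [JS irr gen]] := irredundant_subset b (~: S).
have bh i : i \in J -> 0 < dot (b i) (- d).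
  move=> /(fintype.subsetP JS); rewrite inE (proj2 (gd i)) dotNr oppr_gt0 bd => gi.
  by rewrite lt_def eq_sym gi (proj1 (gd i)).
have [i [iJ giWL]] : exists i, i \in J /\ ~~ (g i <= W + L)%MS.
  apply/not_existsP => H; case/negP: nSL.
  have JL i : i \in J -> (g i <= W + L)%MS.
    by move=> iJ; apply/negPn/negP => gi; apply: (H i).
  have bL i : i \in J -> (b i <= W + L)%MS.
    move=> iJ; rewrite -[b i](subrK (g i)) addmx_sub ?JL //.
    by rewrite -opprB eqmx_opp (submx_trans (gbW i)) ?addsmxSl.
  apply/sumsmx_subP => i _; rewrite genmxE.
  have [iS|iS] := boolP (i \in S).
    by apply: submx_trans (gW i iS) (addsmxSl _ _).
  rewrite -[g i](subrK (b i)) addmx_sub ?(submx_trans (gbW i)) ?addsmxSl //.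
  have [|t _ ->] := gen (b i); first by apply: cone_gen; rewrite inE.
  by apply: summx_sub => j jJ; rewrite scalemx_sub ?bL.
(* A functional exposing the ray of [b i] in the quotient pulls back along [Q] to one exposing
   [S']. *)
have [c bic bc] := irredundant_exposed irr bh iJ.
have gQc l : dot (g l) (Q *m c) = dot (b l) c by rewrite /dot mulmxA.
have bcJ l : l \in J -> dot (b l) c <= 0.
  move=> lJ; have [->|li] := eqVneq l i; first by rewrite bic.
  by rewrite ltW // bc // !inE li.
have bc0 l : l \in S -> dot (b l) c = 0 by move=> /gW/WQ bl; rewrite /b bl dot0l.
have bJ l : l \notin S -> cone b J (b l).
  by move=> lS; apply/gen/cone_gen; rewrite inE.
pose S' : {set I} := [set l | dot (b l) c == 0]%SET.
have SS' : S \subset S'.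
  by apply/fintype.subsetP => l /bc0 bl; rewrite inE bl.
have iS' : i \in S' by rewrite inE bic.
have S'E : (span g S' :=: W + g i)%MS.
  apply/eqmxP/andP; split; last first.
    rewrite addsmx_sub (cone_span (cone_gen g iS')) andbT.
    apply/sumsmx_subP => l lS; rewrite genmxE; apply/cone_span/cone_gen.
    exact: (fintype.subsetP SS').
  (* A generator outside [S] killed by [c] has its image on the ray of [b i], so it adds no further
     dimension. *)
  apply/sumsmx_subP => l; rewrite inE genmxE => /eqP bl.
  have [lS|lS] := boolP (l \in S).
    by apply: submx_trans (gW l lS) (addsmxSl _ _).
  have [t t0 blE] := bJ l lS; rewrite blE in bl.
  have t_eq0 j : j \in J :\ i -> t j = 0.
    move=> ji; have jJ : j \in J by move: ji; rewrite !inE => /andP[].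
    by apply: (sum_dot_eq0 t0 bcJ bl jJ); rewrite lt_eqF // bc.
  have bli : b l = t i *: b i.
    rewrite blE (bigD1 i) //= big1 ?addr0 // => j /andP[jJ ji].
    by rewrite t_eq0 ?scale0r // !inE ji.
  rewrite -[g l](subrK (b l)) addmx_sub ?(submx_trans (gbW l)) ?addsmxSl //.
  rewrite bli scalemx_sub // -[b i](subrK (g i)) addmx_sub ?addsmxSr //.
  by rewrite -opprB eqmx_opp (submx_trans (gbW i)) ?addsmxSl.
exists S'; split=> //.
- exists (Q *m c) => l; rewrite gQc inE; split=> //.
  have [/bc0 -> //|/bJ] := boolP (l \in S); exact: cone_dot_le0.
- apply/eqP; rewrite eqn_leq S'E; apply/andP; split.
    apply: leq_trans (mxrank_adds_leqif _ _) _.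
    by rewrite -[leqRHS]addn1 leq_add2l rank_leq_row.
  apply: rank_ltmx; rewrite /ltmx addsmxSl /=; apply: contra giWL => H.
  by apply: submx_trans (submx_trans (addsmxSr _ _) H) (addsmxSl _ _).
- apply/row_subP => r; set y := row r _.
  have : (y <= span g S' :&: L)%MS by rewrite row_sub.
  rewrite sub_capmx S'E => /andP[/sub_addsmxP[[u v] /= yE] yL].
  have /sub_rVP[a vE] : (v *m g i <= g i)%MS by rewrite submxMl.
  have uW : (u *m W <= W)%MS by rewrite submxMl.
  (* A nonzero coefficient of [g i] would place [g i] in [W + L]. *)
  have [a0|a0] := eqVneq a 0; first by rewrite yE vE a0 scale0r addr0.
  case/negP: giWL; have -> : g i = a^-1 *: (y - u *m W).
    by rewrite yE vE addrC addKr scalerA mulVf ?scale1r.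
  rewrite scalemx_sub // addmx_sub ?(submx_trans yL) ?addsmxSr //.
  by rewrite eqmx_opp (submx_trans uW) ?addsmxSl.
Qed.

(** Since [span g S] meets [L] in the line of [e], the dimension formula bounds the rank of
    [span g S] by [k.+1]. Below that rank, [span g S + L] is not the whole span, so [exposed_extend]
    applies. *)
Lemma exposed_transversal (I : finType) (g : I -> 'rV[R]_m) n (L : 'M[R]_(n, m))
    (S : {set I}) (e : 'rV[R]_m) :
  (L <= span g [set: I])%MS -> exposed g S -> e != 0 ->
  (e <= span g S)%MS -> (e <= L)%MS -> (span g S :&: L <= e)%MS ->
  exists S' : {set I}, [/\ exposed g S',
    \rank (span g S') = (\rank (span g [set: I]) - \rank L).+1,
    (e <= span g S')%MS & (span g S' :&: L <= e)%MS].
Proof.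
move=> LT + e0 + eL; set k := (_ - _)%N.
have spanT S' : (span g S' <= span g [set: I])%MS.
  by apply/sumsmx_subP => i _; rewrite genmxE; apply/cone_span/cone_gen.
have rankL := mxrankS LT.
have rank_sum (S' : {set I}) : (e <= span g S')%MS -> (span g S' :&: L <= e)%MS ->
    (\rank (span g S' + L)%MS).+1 = (\rank (span g S') + \rank L)%N.
  move=> eS Se; rewrite -mxrank_sum_cap -addn1; congr (_ + _)%N.
  have r1 : \rank e = 1%N by rewrite rank_rV e0.
  have eC : (e <= span g S' :&: L)%MS by rewrite sub_capmx eS.
  by apply/eqP; rewrite -r1 eqn_leq !mxrankS.
have rank_le (S' : {set I}) : (e <= span g S')%MS -> (span g S' :&: L <= e)%MS ->
    (\rank (span g S') <= k.+1)%N.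
  move=> eS Se; have := rank_sum S' eS Se.
  have : (\rank (span g S' + L)%MS <= \rank (span g [set: I]))%N.
    by apply: mxrankS; rewrite addsmx_sub spanT.
  by rewrite /k; lia.
elim: {S}(k.+1 - _)%N {-2}S (erefl (k.+1 - \rank (span g S))%N) => [|N IH] S SN.
  move=> expS eS Se; exists S; split=> //.
  by have := rank_le S eS Se; lia.
move=> expS eS Se; have nSL : ~~ (span g [set: I] <= span g S + L)%MS.
  apply/negP => /mxrankS; have := rank_sum S eS Se; move: SN rankL; rewrite /k; lia.
have [S' [expS' SS' rS' capS']] := exposed_extend expS nSL.
apply: (IH S') => //.
- by rewrite rS'; lia.
- apply: submx_trans eS _; apply/sumsmx_subP => i iS; rewrite genmxE.
  exact/cone_span/cone_gen/(fintype.subsetP SS').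
- by apply: submx_trans Se; rewrite sub_capmx capS' capmxSr.
Qed.

(** Generators are indexed by faces of the cone rather than by extreme rays of the slice, so that
    counting faces bounds their number. *)
Lemma slice_generators (I : finType) (g : I -> 'rV[R]_m) n (L : 'M[R]_(n, m)) h :
  (forall i, 0 < dot (g i) h) -> (L <= span g [set: I])%MS ->
  exists w : {set I} -> 'rV[R]_m,
  (forall S, cone g [set: I] (w S) /\ (w S <= L)%MS) /\
  forall x, cone g [set: I] x -> (x <= L)%MS ->
    cone w [set S | `[< exposed g S >] && (\rank (span g S) ==
      (\rank (span g [set: I]) - \rank L).+1)]%SET x.
Proof.
move=> gh LT.
(* Such a [v] spans the line in which [span g S] meets [L]; [w S] is 0 when there is none. *)
pose G S v := [/\ cone g [set: I] v, (v <= L)%MS, v != 0, (v <= span g S)%MS &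
  (span g S :&: L <= v)%MS].
have /choice[w Hw] S : exists v, [/\ cone g [set: I] v, (v <= L)%MS &
    (exists v', G S v') -> G S v].
  have [[v Gv]|nG] := pselect (exists v, G S v); first by exists v; case: Gv.
  by exists 0; split; [exact: cone0|exact: sub0mx|].
exists w; split=> [S|x xC xL]; first by have [] := Hw S.
have [e [eC genC]] := cone_cap_finite g L.
have [T [_ irr genT]] := irredundant_subset e [set: {set I}].
have genC' y : cone g [set: I] y -> (y <= L)%MS -> cone e T y.
  by move=> yC /(genC _ yC)/genT.
apply: cone_trans (genC' x xC xL) => J JT.
have [S0 [expS0 e0 eS0 S0e]] :=
  irredundant_extremal gh (fun J _ => eC J) genC' irr JT.
have [eJC eJL] := eC J.
have [S [expS rS eS Se]] := exposed_transversal LT expS0 e0 eS0 eJL S0e.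
have [_ _ [|wC wL w0 wS Sw]] := Hw S; first by exists (e J).
have /sub_rVP[a eE] : (e J <= w S)%MS.
  by apply: submx_trans Sw; rewrite sub_capmx eS.
have pos v : cone g [set: I] v -> 0 <= dot v h.
  by apply: cone_dot_ge0 => i _; exact: ltW.
have wh : 0 < dot (w S) h.
  rewrite lt_def pos // andbT; apply: contra w0 => /eqP wh.
  by apply/eqP/(cone_dot_eq0 _ wC wh) => i _; exact: gh.
(* The factor is nonnegative because [h] is nonnegative at [e J] and positive at [w S]. *)
rewrite eE; apply: coneZ.
  by rewrite -(pmulr_lge0 _ wh) -dotZl -eE pos.
by apply: cone_gen; rewrite inE rS eqxx andbT; apply/asboolP.
Qed.

End Cones.

(** * Ranks and cardinals *)

Section NatExtrema.
Local Open Scope classical_set_scope.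
Implicit Types (S : set nat).

Lemma nat_min_spec S k : S k -> S (nat_min S) /\ (nat_min S <= k)%N.
Proof.
move=> Sk; have exS : exists n, `[< S n >] by exists k; apply/asboolP.
have [|Smin lb] := @xgetPex _ 0%N (S `&` lbound S).
  case: (ex_minnP exS) => n /asboolP Sn nmin; exists n; split=> // j Sj.
  by rewrite leEnat; apply/nmin/asboolP.
by split=> //; rewrite -leEnat; exact: lb.
Qed.

(** Nonemptiness and the bound [B] rule out the default value of [nat_max]. *)
Lemma nat_max_ge S k B : S k -> (forall j, S j -> (j <= B)%N) -> (k <= nat_max S)%N.
Proof.
move=> Sk SB; have exS : exists n, `[< S n >] by exists k; apply/asboolP.
have bnd n : `[< S n >] -> (n <= B)%N by move=> /asboolP /SB.
have [|Smax ub] := @xgetPex _ 0%N (S `&` ubound S).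
  case: (ex_maxnP exS bnd) => n /asboolP Sn nmax; exists n; split=> // j Sj.
  by rewrite leEnat; apply/nmax/asboolP.
by rewrite -leEnat; exact: ub.
Qed.

End NatExtrema.

Section CardBounds.
Local Open Scope classical_set_scope.
Local Open Scope card_scope.

Lemma card_le_finType (T : finType) (A : set T) : A #<= `I_#|T|.
Proof.
have inj : {in A &, injective (@enum_rank T)} by move=> x y _ _ /enum_rank_inj.
rewrite -(card_le_eql (inj_card_eq inj)) (card_le_eqr card_II).
exact: card_leT.
Qed.

Lemma card_ge_finset (T : finType) (U : Type) (X : {set T}) (F : T -> U) (A : set U) :
  {in X &, injective F} -> (forall x, x \in X -> A (F x)) -> `I_#|X| #<= A.
Proof.
move=> inj XA.
have inj' : {in [set: 'I_#|X|] &, injective (F \o enum_val)}.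
  by move=> i j _ _ /inj eq_ij; apply/enum_val_inj/eq_ij; exact: enum_valP.
rewrite (card_le_eql card_II) -(card_le_eql (inj_card_eq inj')).
by apply: subset_card_le => _ [i _ <-] /=; exact/XA/enum_valP.
Qed.

End CardBounds.

(** * Nonnegative factorizations as cone membership of columns *)

Section Factorizations.
Variable R : realType.

Lemma cone_factor (K : finType) m n (w : K -> 'rV[R]_m) (T : {set K})
    (M : 'M[R]_(m, n)) :
  (forall j, cone w T (row j M^T)) ->
  exists2 V, nonneg_mx V & M = (\matrix_(i < m, j < #|T|) w (enum_val j) 0 i) *m V.
Proof.
move=> wM; have /choice[t tP] j : exists t : K -> R,
    (forall k, 0 <= t k) /\ row j M^T = \sum_(k in T) t k *: w k.
  by have [t t0 tE] := wM j; exists t.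
exists (\matrix_(j, l) t l (enum_val j)) => [j l|]; first by rewrite mxE; exact: (tP l).1.
apply/matrixP => i l; have /rowP/(_ i) := (tP l).2; rewrite !mxE => ->.
rewrite summxE big_enum_val; apply: eq_bigr => j _.
by rewrite !mxE mulrC.
Qed.

Lemma nnrank_le (K : finType) m n (w : K -> 'rV[R]_m) (T : {set K})
    (M : 'M[R]_(m, n)) :
  (forall k, nonneg_mx (w k)) -> (forall j, cone w T (row j M^T)) ->
  (nnrank M <= #|T|)%N.
Proof.
move=> w0 /cone_factor[V V0 ME]; apply: (nat_min_spec _).2.
exists (\matrix_(i < m, j < #|T|) w (enum_val j) 0 i), V.
by split; [move=> i j; rewrite mxE; exact: w0|exact: V0|exact: ME].
Qed.

(** Generators inside the column space of [M] keep the rank of the left factor at most that of [M];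
    the factorization gives the reverse inequality. *)
Lemma restricted_nnrank_le (K : finType) m n (w : K -> 'rV[R]_m) (T : {set K})
    (M : 'M[R]_(m, n)) :
  (forall k, nonneg_mx (w k)) -> (forall k, (w k <= M^T)%MS) ->
  (forall j, cone w T (row j M^T)) -> (restricted_nnrank M <= #|T|)%N.
Proof.
move=> w0 wM /cone_factor[V V0 ME]; apply: (nat_min_spec _).2.
exists (\matrix_(i < m, j < #|T|) w (enum_val j) 0 i), V.
split; [move=> i j; rewrite mxE; exact: w0|exact: V0|exact: ME|].
apply/eqP; rewrite eqn_leq; apply/andP; split; last by rewrite {1}ME mxrankM_maxl.
rewrite -mxrank_tr -[leqRHS]mxrank_tr.
apply/mxrankS/row_subP => j; set r := row j _; have -> : r = w (enum_val j); last exact: wM.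
by apply/matrixP => i k; rewrite !mxE ord1.
Qed.

Lemma nnrank_attained m n (M : 'M[R]_(m, n)) : nonneg_mx M ->
  exists (U : 'M[R]_(m, nnrank M)) (V : 'M[R]_(nnrank M, n)),
  [/\ nonneg_mx U, nonneg_mx V & M = U *m V].
Proof.
move=> M0; suff /nat_min_spec[] : [set k | exists (U : 'M[R]_(m, k))
    (V : 'M[R]_(k, n)), [/\ nonneg_mx U, nonneg_mx V & M = U *m V]]%classic n by [].
exists M, 1%:M; split=> // [i j|]; last by rewrite mulmx1.
by rewrite mxE ler0n.
Qed.

End Factorizations.

(** * Faces of polytopes *)

Section Polytopes.
Variables (R : realType) (D : nat).
Local Open Scope classical_set_scope.
Local Open Scope card_scope.
Implicit Types (x : 'rV[R]_D) (P F : set 'rV[R]_D).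

Lemma conv_rowsP q (V : 'M[R]_(q, D)) x : conv_rows V x <->
  exists t : 'I_q -> R, [/\ forall i, 0 <= t i,
    \sum_(i in [set: 'I_q]%SET) t i = 1 &
    x = \sum_(i in [set: 'I_q]%SET) t i *: row i V].
Proof.
have eqT (W : nmodType) (f : 'I_q -> W) :
    \sum_(i in [set: 'I_q]%SET) f i = \sum_i f i.
  by apply: eq_bigl => i; rewrite finset.in_setT.
split=> [[t [t0 t1 ->]]|[t [t0 t1 ->]]].
  exists (t 0); split=> [i||]; first exact: t0.
    by rewrite eqT.
  by rewrite eqT mulmx_sum_row.
exists (\row_i t i); split=> [i j||]; first by rewrite mxE.
  by rewrite -t1 eqT; apply: eq_bigr => i _; rewrite mxE.
by rewrite mulmx_sum_row eqT; apply: eq_bigr => i _; rewrite mxE.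
Qed.

Lemma conv_rows_row q (V : 'M[R]_(q, D)) i : conv_rows V (row i V).
Proof.
exists (delta_mx 0 i); split=> [j k||]; first by rewrite mxE ler0n.
  rewrite (bigD1 i) //= mxE !eqxx big1 ?addr0 // => j /negPf ji.
  by rewrite mxE ji andbF.
by rewrite -rowE.
Qed.

(* Affine conditions on points become linear conditions on their lifts. *)
Definition lift1 x : 'rV[R]_(D + 1) := row_mx x 1.

Lemma lift1_comb (I : finType) (v : I -> 'rV[R]_D) (t : I -> R) (J : {set I}) x :
  \sum_(i in J) t i *: lift1 (v i) = lift1 x <->
  \sum_(i in J) t i *: v i = x /\ \sum_(i in J) t i = 1.
Proof.
have -> : \sum_(i in J) t i *: lift1 (v i) =
    row_mx (\sum_(i in J) t i *: v i) (\sum_(i in J) t i)%:M.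
  apply: (big_ind3 (fun y z a => y = row_mx z a%:M)) => [|_ z a _ z' a' -> ->|i _].
  - by rewrite raddf0 row_mx0.
  - by rewrite add_row_mx raddfD.
  - by rewrite /lift1 scale_row_mx scalemx1.
split=> [/eq_row_mx[-> t1]|[-> ->]] //; split=> //.
by have := congr1 (fun A : 'M_1 => A 0 0) t1; rewrite !mxE.
Qed.

Lemma dot_lift1 x c : dot (lift1 x) c = dot x (usubmx c) + dsubmx c 0 0.
Proof. by rewrite /dot -{1}[c]vsubmxK mul_row_col mul1mx mxE. Qed.

(** A functional exposing the lifted row splits into a linear part and a constant, which is the
    affine inequality defining the face. *)
Lemma vertex_face q (V : 'M[R]_(q, D)) (J : {set 'I_q}) i :
  let g := fun j => lift1 (row j V) in
  irredundant g J -> (forall y, cone g [set: 'I_q]%SET y -> cone g J y) ->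
  i \in J -> face (conv_rows V) [set row i V].
Proof.
move=> g irr gen iJ; pose h : 'cV[R]_(D + 1) := col_mx 0 1.
have gh x : dot (lift1 x) h = 1.
  by rewrite dot_lift1 col_mxKu col_mxKd dot0r add0r mxE.
have [|c ic jc] := irredundant_exposed (h := h) irr _ iJ.
  by move=> j _; rewrite gh.
have cJ j : j \in J -> dot (g j) c <= 0.
  by move=> jJ; have [->|ji] := eqVneq j i; [rewrite ic|rewrite ltW // jc // !inE ji].
have dotE x : dot x (usubmx c) = dot (lift1 x) c - dsubmx c 0 0.
  by rewrite dot_lift1 addrK.
have PJ x : conv_rows V x -> cone g J (lift1 x).
  move=> /conv_rowsP[t [t0 t1 xE]]; apply: gen; exists t => //.
  exact/esym/lift1_comb.
exists (usubmx c), (- dsubmx c 0 0); split=> [x Px|].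
  rewrite -/(dot _ _) dotE gerDr; exact: cone_dot_le0 (PJ x Px).
apply/seteqP; split=> [_ ->|x [Px]] /=.
  by split; [exact: conv_rows_row|rewrite -/(dot _ _) dotE ic add0r].
rewrite -/(dot _ _) dotE => /eqP; rewrite -subr_eq0 opprK subrK => /eqP xc.
have [t t0 xE] := PJ x Px.
rewrite xE in xc; have tj := sum_dot_eq0 t0 cJ xc.
have tj0 j : j \in J -> j != i -> t j = 0.
  by move=> jJ ji; apply: tj => //; rewrite lt_eqF // jc // !inE ji.
have [<- t1] := (lift1_comb _ _ _ _).1 (esym xE).
have ti : t i = 1.
  by rewrite -t1 (bigD1 i) //= big1 ?addr0 // => j /andP[jJ /tj0 ->].
rewrite (bigD1 i) //= ti scale1r big1 ?addr0 // => j /andP[jJ /tj0 ->] //.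
by rewrite scale0r.
Qed.

Lemma has_dim_set1 x : has_dim [set x] 0.
Proof.
exists x, 0; split; first by rewrite mxrank0.
apply/seteqP; split=> [y [k [V [t [Vx t1 yE]]]]|y [w]] /=.
  exists 0; rewrite /= ?sub0mx // addr0 yE mulmx_sum_row.
  under eq_bigr do rewrite Vx.
  by rewrite -scaler_suml t1 scale1r.
rewrite submx0 => /eqP -> <-; rewrite addr0; exists 1%N, x, 1; split=> [i||].
- by apply/rowP => j; rewrite mxE ord1.
- by rewrite big_ord1 mxE.
- by rewrite mul1mx.
Qed.

Lemma has_dim0 F : has_dim F 0 -> exists x, F = [set x].
Proof.
move=> [x [W [/eqP]]]; rewrite mxrank_eq0 => /eqP -> affF; exists x.
have inj y : affine_hull F y -> y = x.
  by rewrite affF => -[w /=]; rewrite submx0 => /eqP -> <-; rewrite addr0.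
have Fx y : F y -> y = x.
  move=> Fy; apply: inj; exists 1%N, y, 1; split=> [i||].
  - by suff -> : row i y = y by []; apply/rowP => j; rewrite mxE ord1.
  - by rewrite big_ord1 mxE.
  - by rewrite mul1mx.
have : affine_hull F x by rewrite affF; exists 0; rewrite /= ?sub0mx ?addr0.
(* The empty family is impossible because its coefficients sum to 0, so [F] contains a point. *)
move=> [[|k] [V [t [VF t1 _]]]].
  by move: t1; rewrite big_ord0 => /eqP; rewrite eq_sym oner_eq0.
by apply/seteqP; split=> [y /Fx //|_ ->]; rewrite -(Fx _ (VF 0)); exact: VF.
Qed.

(** A valid inequality is tight at a convex combination exactly when it is tight at every point of
    nonzero weight. *)
Lemma face_comb P F (I : finType) (J : {set I}) (t : I -> R) (v : I -> 'rV[R]_D) :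
  face P F -> (forall i, i \in J -> P (v i)) -> (forall i, 0 <= t i) ->
  \sum_(i in J) t i = 1 -> P (\sum_(i in J) t i *: v i) ->
  F (\sum_(i in J) t i *: v i) <-> forall i, i \in J -> t i != 0 -> F (v i).
Proof.
move=> [c [b [Pc ->]]] vP t0 t1 Px.
have sumE : dot (\sum_(i in J) t i *: v i) c - b =
    \sum_(i in J) t i * (dot (v i) c - b).
  rewrite dot_suml -[b in LHS]mul1r -t1 mulr_suml -sumrB.
  by apply: eq_bigr => i _; rewrite dotZl mulrBr.
split=> [[_ /= xb] i iJ ti|vF]; last first.
  split=> //=; rewrite -/(dot _ _); apply/eqP; rewrite -subr_eq0 sumE big1 // => i iJ.
  have [->|/(vF i iJ)[_ /= ]] := eqVneq (t i) 0; first by rewrite mul0r.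
  by rewrite -/(dot _ _) => ->; rewrite subrr mulr0.
split; first exact: vP.
move/eqP: xb; rewrite -/(dot _ _) -subr_eq0 sumE -oppr_eq0 -sumrN psumr_eq0.
  move=> /allP/(_ i (mem_index_enum i)); rewrite iJ /= oppr_eq0 mulf_eq0.
  by rewrite (negPf ti) /= subr_eq0 => /eqP.
by move=> j jJ; rewrite oppr_ge0 mulr_ge0_le0 // subr_le0; exact/Pc/vP.
Qed.

(** A face is determined by the vertices it contains, since the irredundant rows of [V] are vertices
    and generate [P]. [phi] records these vertices through the numbering [f]. *)
Lemma kfaces_card_bound P n k :
  polytope P -> kfaces P 0 #= `I_n -> kfaces P k #<= `I_(2 ^ n).
Proof.
move=> [q [V PE]] /card_set_bijP[f [fn finj _]].
pose g j := lift1 (row j V).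
have [J [_ irr gen]] := irredundant_subset g [set: 'I_q]%SET.
have vert i : i \in J -> kfaces P 0 [set row i V].
  by move=> iJ; split; [rewrite PE; exact: vertex_face gen iJ|exact: has_dim_set1].
have combP x : P x -> exists t : 'I_q -> R, [/\ forall i, 0 <= t i,
    \sum_(i in J) t i = 1 & x = \sum_(i in J) t i *: row i V].
  rewrite PE => /conv_rowsP[t [t0 t1 xE]].
  have [|s s0 /esym/lift1_comb[<- s1]] := gen (lift1 x).
    by exists t => //; exact/esym/lift1_comb.
  by exists s.
pose phi F : {set 'I_n} :=
  [set i : 'I_n | `[< exists2 v, kfaces P 0 v /\ v `<=` F & f v = i >]]%SET.
have sub F F' : face P F -> face P F' -> phi F = phi F' -> F `<=` F'.
  move=> fF fF' phiE x Fx.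
  have Px : P x by case: fF Fx => c [b [_ ->]] [].
  have [t [t0 t1 xE]] := combP x Px; rewrite xE in Fx Px *.
  have vP i : i \in J -> P (row i V) by rewrite PE => _; exact: conv_rows_row.
  apply/(face_comb fF' vP t0 t1 Px) => i iJ ti.
  have Fi := (face_comb fF vP t0 t1 Px).1 Fx i iJ ti.
  have fi : (f [set row i V] < n)%N by exact/fn/vert.
  have : Ordinal fi \in phi F.
    rewrite inE; apply/asboolP; exists [set row i V] => //; split; first exact: vert.
    by move=> _ ->.
  rewrite phiE inE => /asboolP[v [vK vF'] /= fE].
  have vE : v = [set row i V].
    by apply: finj; rewrite ?inE //; exact: vert.
  by apply: vF'; rewrite vE.
have phi_inj : {in kfaces P k &, injective phi}.
  move=> F F'; rewrite !inE => -[fF _] [fF' _] FF'.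
  by apply/seteqP; split; exact: sub.
rewrite -(card_le_eql (inj_card_eq phi_inj)).
have <- : #|{set 'I_n}| = (2 ^ n)%N.
  by rewrite -cardsT -powersetT card_powerset cardsT card_ord.
exact: card_le_finType.
Qed.

End Polytopes.

(** * Polytopes as hyperplane sections of cones *)

Section NormalizedPolytopes.
Local Open Scope classical_set_scope.
Local Open Scope card_scope.
Variables (R : realType) (D q : nat) (A : 'M[R]_(q, D)) (h : 'cV[R]_D).
Hypothesis Ah : forall i, dot (row i A) h = 1.
Implicit Types (S : {set 'I_q}).

Let g i := row i A.

Definition face_of S : set 'rV[R]_D := [set x | cone g S x /\ dot x h = 1].

Lemma conv_rowsE : conv_rows A = face_of [set: 'I_q]%SET.
Proof.
apply/seteqP; split=> x.
  move=> /conv_rowsP[t [t0 t1 ->]]; split; first by exists t.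
  by rewrite dot_suml -t1; apply: eq_bigr => i _; rewrite dotZl Ah mulr1.
move=> [[t t0 ->] t1]; apply/conv_rowsP; exists t; split=> //.
by rewrite -t1 dot_suml; apply: eq_bigr => i _; rewrite dotZl Ah mulr1.
Qed.

Lemma face_of_face S : exposed g S -> face (conv_rows A) (face_of S).
Proof.
move=> [c cP]; have gc i : dot (g i) c <= 0 by exact: (cP i).1.
exists c, 0; rewrite conv_rowsE; split=> [x [xC _]|].
  by apply: cone_dot_le0 xC => i _; exact: gc.
apply/seteqP; split=> [x [xC x1]|x [[xC x1] /= xc]].
  split; first by split=> //; apply: coneS xC; exact: finset.subsetT.
  case: xC => t t0 ->; rewrite /= -/(dot _ _) dot_suml big1 // => i iS.
  by move: iS; rewrite dotZl (cP i).2 => /eqP ->; rewrite mulr0.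
split=> //; case: xC xc => t t0 -> xc; exists t => //.
rewrite [LHS](bigID [in S]) /= [X in _ + X]big1 ?addr0 => [|i /andP[_ iS]].
  by apply: eq_bigl => i; rewrite finset.in_setT.
have ti := sum_dot_eq0 t0 (fun i _ => gc i) xc (finset.in_setT i).
by rewrite ti ?scale0r // -(cP i).2.
Qed.

Lemma face_of_row S i : exposed g S -> face_of S (g i) -> i \in S.
Proof.
move=> [c cP] [[t t0 giE] _]; rewrite (cP i).2 giE dot_suml big1 // => j jS.
by move: jS; rewrite dotZl (cP j).2 => /eqP ->; rewrite mulr0.
Qed.

Lemma row_face_of S i : i \in S -> face_of S (g i).
Proof. by move=> iS; split; [exact: cone_gen|exact: Ah]. Qed.

Lemma face_of_inj S S' : exposed g S -> exposed g S' -> face_of S = face_of S' ->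
  S = S'.
Proof.
move=> expS expS' SS'; apply/setP => i; apply/idP/idP => /row_face_of.
  by rewrite SS' => /(face_of_row expS').
by rewrite -SS' => /(face_of_row expS).
Qed.

Lemma affine_hull_face_of S i0 : i0 \in S ->
  affine_hull (face_of S) = [set x | (x <= span g S)%MS /\ dot x h = 1].
Proof.
move=> i0S; apply/seteqP; split=> x.
  move=> [k [V [t [VS t1 ->]]]]; rewrite mulmx_sum_row; split=> /=.
    by apply: summx_sub => i _; rewrite scalemx_sub // cone_span //; exact: (VS i).1.
  rewrite dot_suml -t1; apply: eq_bigr => i _.
  by rewrite dotZl (VS i).2 mulr1.
move=> [/spanP[u xE] x1]; pose t : 'rV[R]_q := \row_i if i \in S then u i else 0.
(* Every listed point must lie in the face, so rows outside [S] are replaced by row [i0] with weight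
   0. *)
exists q, (\matrix_(i < q) g (if i \in S then i else i0)), t; split.
- by move=> i; rewrite rowK; apply: row_face_of; case: ifP.
- rewrite -x1 xE dot_suml [RHS]big_mkcond; apply: eq_bigr => i _; rewrite mxE.
  by case: ifP => // _; rewrite dotZl Ah mulr1.
- rewrite mulmx_sum_row xE big_mkcond; apply: eq_bigr => i _.
  by rewrite mxE rowK; case: ifP; rewrite ?scale0r.
Qed.

(** The directions of the affine hull form the kernel of [h] on [span g S]; as [h] is 1 at [g i0],
    this costs one dimension. *)
Lemma has_dim_face_of S i0 : i0 \in S ->
  has_dim (face_of S) (\rank (span g S) - 1).
Proof.
move=> i0S; have g0 : (g i0 <= span g S)%MS by exact/cone_span/cone_gen.
exists (g i0), (span g S :&: kermx h)%MS; split.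
  rewrite -(mxrank_mul_ker (span g S) h).
  have -> : \rank (span g S *m h) = 1%N; last by rewrite addKn.
  apply/eqP; rewrite eqn_leq rank_leq_col lt0n mxrank_eq0 /=; apply/eqP => Sh.
  have /submxP[u gE] := g0; have := Ah i0; rewrite -/(g i0) /dot gE -mulmxA Sh.
  by rewrite mulmx0 mxE => /eqP; rewrite eq_sym oner_eq0.
rewrite (affine_hull_face_of i0S); apply/seteqP; split=> [x [xS x1]|_ [w /= wS <-]].
  exists (x - g i0); last by rewrite addrC subrK.
  rewrite /= sub_capmx addmx_sub ?eqmx_opp //=; apply/sub_kermxP.
  by apply/matrixP => i j; rewrite !ord1 -/(dot _ _) dotDl dotNl x1 Ah subrr mxE.
move: wS; rewrite sub_capmx => /andP[wS /sub_kermxP wh]; split=> /=.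
  by rewrite addmx_sub.
by rewrite dotDl Ah /dot wh mxE addr0.
Qed.

(** If [{x}] is a face, any row of nonzero weight in [x] equals [x] by [face_comb]. Irredundancy
    makes each row a vertex and the rows distinct. *)
Lemma kfaces0_rows : irredundant g [set: 'I_q]%SET ->
  kfaces (conv_rows A) 0 #= `I_q.
Proof.
move=> irr; have rowx i : kfaces (conv_rows A) 0 [set g i].
  split; last exact: has_dim_set1.
  apply: (vertex_face (J := [set: 'I_q]%SET)) => // j _ [t t0 /esym/lift1_comb[xE _]].
  by apply: (irr j) => //; exists t.
have -> : kfaces (conv_rows A) 0 = (fun i => [set g i]) @` [set: 'I_q].
  apply/seteqP; split=> [F [fF /has_dim0[x FE]]|_ [i _ <-]]; last exact: rowx.
  have Px : conv_rows A x by case: (fF) => c [b [_ FE']]; have [] :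
    (conv_rows A `&` [set x | (x *m c) 0 0 = b]) x by rewrite -FE' FE.
  have [t [t0 t1 xE]] := (conv_rowsP _ _).1 Px.
  have [i ti] : exists i, t i != 0.
    apply/not_existsP => H; move: t1; rewrite big1 => [/eqP|i _].
      by rewrite eq_sym oner_eq0.
    by apply/eqP/negPn/negP/H.
  exists i => //; rewrite FE; congr [set _]; rewrite FE in fF.
  rewrite xE in Px fF *.
  have vP j : j \in [set: 'I_q]%SET -> conv_rows A (row j A).
    by move=> _; exact: conv_rows_row.
  by apply: ((face_comb fF vP t0 t1 Px).1 _ i).
apply: (card_eq_trans (B := [set: 'I_q])); last exact/card_esym/card_II.
apply: inj_card_eq => i j _ _ ij.
have gij : g i = g j by have : [set g j] (g i) by rewrite -ij.
apply/eqP/negPn/negP => /negPf nij; apply: (irr i); first exact: finset.in_setT.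
by rewrite gij; apply: cone_gen; rewrite !inE eq_sym nij.
Qed.

Lemma card_exposed_le k : irredundant g [set: 'I_q]%SET ->
  (#|[set S : {set 'I_q} | `[< exposed g S >] && (\rank (span g S) == k.+1)]%SET|
    <= max_faces R q (\rank (span g [set: 'I_q]%SET) - 1) k)%N.
Proof.
move=> irr; set X := finset _.
have polyA : polytope (conv_rows A) by exists q, A.
have vertA := kfaces0_rows irr.
have X_neq0 S : S \in X -> exists i, i \in S.
  rewrite inE => /andP[_ /eqP rS]; have [S0|[i iS]] := set_0Vmem S; last by exists i.
  by move: rS; rewrite S0 /span big_set0 mxrank0.
(* If [X] is nonempty, [i0] witnesses that the polytope has a row, hence a dimension. *)
have [->|[S0 /X_neq0[i0 _]]] := set_0Vmem X; first by rewrite cards0.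
have XF S : S \in X -> kfaces (conv_rows A) k (face_of S).
  move=> SX; have [j jS] := X_neq0 S SX; move: SX; rewrite inE.
  move=> /andP[/asboolP expS /eqP rS]; split; first exact: face_of_face.
  by have := has_dim_face_of jS; rewrite rS subn1.
have inj : {in X &, injective face_of}.
  move=> S S'; rewrite !inE => /andP[/asboolP expS _] /andP[/asboolP expS' _].
  exact: face_of_inj.
have bound := kfaces_card_bound k polyA vertA.
have [N AN] : exists N, kfaces (conv_rows A) k #= `I_N.
  by apply/finite_setP; apply: card_le_finite bound (finite_II _).
have XN : (#|X| <= N)%N.
  rewrite -card_le_II -(card_le_eqr AN); exact: card_ge_finset inj XF.
apply: leq_trans XN _; apply: (@nat_max_ge _ _ (2 ^ q)%N).
  exists D, (conv_rows A); split=> //.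
  rewrite conv_rowsE; exact: has_dim_face_of (finset.in_setT i0).
(* The bound must hold for all polytopes with [q] vertices, since [nat_max] is 0 on unbounded
   sets. *)
move=> j [D' [P [polyP _ vertP facesP]]].
by rewrite -card_le_II -(card_le_eql facesP); exact: kfaces_card_bound.
Qed.

End NormalizedPolytopes.

(** * Assembly of the bound from a minimal factorization *)

Theorem theorem5 (R : realType) (m n : nat) (M : 'M[R]_(m, n))
    (hM : nonneg_mx M) :
  (restricted_nnrank M <=
   \max_(\rank M <= ru < (nnrank M).+1)
     max_faces R (nnrank M) (ru - 1) (ru - \rank M))%N.
Proof.
have [U [V [U0 V0 ME]]] := nnrank_attained hM.
set p := nnrank M in U V U0 V0 ME *.
pose h : 'cV[R]_m := const_mx 1; pose g0 i := row i U^T.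
have g00 i : nonneg_mx (g0 i) by move=> j k; rewrite !mxE.
have doth x : dot x h = \sum_j x 0 j.
  by rewrite /dot mxE; apply: eq_bigr => j _; rewrite mxE mulr1.
have sum0 x : nonneg_mx x -> 0 <= dot x h.
  by move=> x0; rewrite doth sumr_ge0.
(* A zero column of [U] gives a zero row here, since the inverse of 0 is 0; [g0E] still holds for
   it. *)
pose A : 'M[R]_(p, m) := \matrix_(i < p) ((dot (g0 i) h)^-1 *: g0 i).
pose g i := row i A.
have gE i : g i = (dot (g0 i) h)^-1 *: g0 i by rewrite /g rowK.
have g_ge0 i : nonneg_mx (g i).
  by move=> j k; rewrite gE mxE mulr_ge0 ?invr_ge0 ?sum0 //; exact: g00.
have g0E i : g0 i = dot (g0 i) h *: g i.
  rewrite gE scalerA; have [s0|s0] := eqVneq (dot (g0 i) h) 0.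
    rewrite s0 mul0r scale0r; apply/rowP => j; rewrite [RHS]mxE.
    move/eqP: s0; rewrite doth psumr_eq0 => [|k _]; last exact: g00.
    by move=> /allP/(_ j (mem_index_enum j))/eqP.
  by rewrite mulfV // scale1r.
have coneM j : cone g [set: 'I_p] (row j M^T).
  exists (fun i => V i j * dot (g0 i) h) => [i|]; first by rewrite mulr_ge0 ?sum0.
  rewrite ME trmx_mul row_mul mulmx_sum_row.
  apply: eq_big => [i|i _]; first by rewrite finset.in_setT.
  by rewrite -/(g0 i) -scalerA -g0E !mxE.
(* Fewer generators would give a nonnegative factorization smaller than the minimum [p]. *)
have irr : irredundant g [set: 'I_p].
  have [J [_ irr gen]] := irredundant_subset g [set: 'I_p].
  have pJ : (p <= #|J|)%N by apply: nnrank_le g_ge0 _ => j; exact: gen.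
  suff <- : J = [set: 'I_p] by [].
  by apply/eqP; rewrite eqEcard finset.subsetT cardsT card_ord.
(* A column with sum 0 would yield a zero generator, which is redundant. *)
have gh i : dot (g i) h = 1.
  rewrite gE dotZl mulVf //; apply/eqP => s0; apply: (irr i).
    exact: finset.in_setT.
  by rewrite gE s0 invr0 scale0r; exact: cone0.
have MT : (M^T <= span g [set: 'I_p])%MS.
  by apply/row_subP => j; apply: cone_span.
have [|w [wP wgen]] := slice_generators (h := h) _ MT.
  by move=> i; rewrite gh.
have w_ge0 S : nonneg_mx (w S).
  have [[t t0 ->] _] := wP S; move=> i j; rewrite summxE sumr_ge0 // => k _.
  by rewrite mxE mulr_ge0 //; exact: g_ge0.
have := restricted_nnrank_le w_ge0 (fun S => (wP S).2)
  (fun j => wgen _ (coneM j) (row_sub j _)).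
set ru := \rank (span g _); rewrite mxrank_tr => restr.
have ruM : (\rank M <= ru)%N by rewrite -mxrank_tr mxrankS.
have rup : (ru <= p)%N.
  apply: leq_trans (rank_leq_row A); apply: mxrankS; apply/sumsmx_subP => i _.
  by rewrite genmxE row_sub.
apply: leq_trans restr _.
apply: leq_trans (card_exposed_le gh _ irr) _.
have ru_in : ru \in index_iota (\rank M) p.+1 by rewrite mem_index_iota ruM.
exact: (leq_bigmax_seq _ ru_in isT).
Qed.
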